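(* Let $(M_n)_{n\ge 0}$ be a nonnegative supermartingale with respect to a filtration $(\mathcal{F}_n)_{n\ge 0}$, with $M_0=1$, let $b>1$, let $T_b=\inf\{n\ge 1: M_n\ge b\}$, and assume $\mathbb{E}[M_{T_b}\mathbf{1}(T_b<\infty)]<\infty$. Then the limit $$R_b=\lim_{n\to\infty}\mathbb{E}[M_n\mathbf{1}(T_b>n)]$$ exists, $0\le R_b<\infty$, and $$\mathbb{E}[M_{T_b}\mathbf{1}(T_b<\infty)]=1-D_b-R_b,$$ so that $$\mathbb{P}(T_b<\infty)=\frac{1-D_b-R_b}{b+O_b}.$$
   Context: A nonnegative adapted process $(M_n,\mathcal{F}_n)_{n\ge0}$ with $\mathbb{E}[M_n]<\infty$ for all $n$ is a supermartingale if $\mathbb{E}[M_n\mid\mathcal{F}_{n-1}]\le M_{n-1}$ almost surely for every $n\ge1$. Convention: $\inf\varnothing=\infty$. The decrement at time $n\ge1$ is $\delta_n=M_{n-1}-\mathbb{E}[M_n\mid\mathcal{F}_{n-1}]\ge0$. The supermartingale loss is $D_b=\sum_{i=1}^\infty\mathbb{E}[\delta_i\mathbf{1}(T_b\ge i)]$. The expected overshoot is $O_b=\mathbb{E}[M_{T_b}-b\mid T_b<\infty]$, with the convention $O_b=0$ if $\mathbb{P}(T_b<\infty)=0$. *)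

(* Defs.v *)
From HB Require Import structures.
From mathcomp Require Import all_boot all_order all_algebra.
From mathcomp Require Import all_classical all_reals all_analysis.
From mathcomp Require Import measurable_realfun.

Set Implicit Arguments.
Unset Strict Implicit.
Unset Printing Implicit Defensive.

Import Order.TTheory GRing.Theory Num.Theory.
Import numFieldNormedType.Exports.

Local Open Scope classical_set_scope.
Local Open Scope ring_scope.

(* g_sigma_algebraType G is T with the sigma-algebra <<s G >>, which is G itself
   when G is already a sigma-algebra. *)
Definition measurable_wrt d (T : measurableType d) (R : realType)
    (G : set (set T)) (X : T -> R) : Prop :=
  measurable_fun [set: g_sigma_algebraType G]
    (X : g_sigma_algebraType G -> R).

Section conditional_expectation.
Context d (T : measurableType d) (R : realType) (P : probability T R).
Implicit Types (G : set (set T)) (X Y : T -> R).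

Definition is_cond_exp G X Y : Prop :=
  [/\ measurable_wrt G Y,
      P.-integrable [set: T] (EFin \o Y) &
      forall A, G A ->
        (\int[P]_(w in A) (Y w)%:E = \int[P]_(w in A) (X w)%:E)%E].

(* A version of E[X | G], picked by choice. For X integrable and G a
   sub-sigma-algebra, it is one indeed (cond_expP), so that the default value 0
   is not used, and any two versions agree almost surely (cond_exp_unique). *)
Definition cond_exp G X : T -> R := xget (cst 0) [set Y | is_cond_exp G X Y].

Lemma cond_exp_exists G X : sigma_algebra setT G -> G `<=` measurable ->
  P.-integrable [set: T] (EFin \o X) -> exists Y, is_cond_exp G X Y.
Proof.
move=> sG Gm iX; pose T' := g_sigma_algebraType G.
have GE : (@measurable _ T') = G := sigma_algebra_id sG.
have mid : measurable_fun [set: T] (id : T -> T').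
  by move=> _ B mB; rewrite setTI; apply: Gm; rewrite -GE.
pose idm : {mfun T >-> T'} := mfun_Sub (mem_set mid).
pose mu : probability T' R := distribution P idm.
pose ind : {charge set T -> \bar R} := induced_charge iX.
have [nu nuE] : exists nu : {charge set T' -> \bar R},
    forall A, nu A = (\int[P]_(w in A) (X w)%:E)%E.
  by unshelve eexists (pushforward ind (id : T -> T') : {charge set T' -> \bar R}).
have P0 (A : set T) : measurable A -> P A = 0%E ->
    (\int[P]_(w in A) (X w)%:E)%E = 0%E.
  move=> mA PA; apply: null_set_integral => //.
  by apply: measurable_funTS; exact: measurable_int iX.
have numu : nu `<< mu.
  apply/null_content_dominatesP => A mA muA; rewrite nuE.
  by apply: P0 => //; apply: Gm; rewrite -GE.
pose f : T' -> \bar R := Radon_Nikodym nu mu.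
have ffin x : f x \is a fin_num by exact: Radon_Nikodym_fin_num.
have fi : mu.-integrable [set: T'] f by exact: Radon_Nikodym_integrable.
have mf : measurable_fun [set: T'] f by exact: measurable_int fi.
have fE : EFin \o (fine \o f) = f by apply/funext => x /=; rewrite fineK.
have fPi : P.-integrable [set: T] (f : T -> \bar R).
  apply/integrableP; split; first exact: (measurableT_comp mf mid).
  case/integrableP: fi => _; apply: le_lt_trans.
  by rewrite ge0_integral_pushforward//; exact: measurableT_comp.
exists (fine \o f); split.
- by apply: measurableT_comp => //.
- by rewrite fE.
- move=> A GA; have mA : measurable (A : set T') by rewrite GE.
  have -> : (\int[P]_(w in A) ((fine \o f) w)%:E = \int[P]_(w in A) f w)%E.
    by apply: eq_integral => w _ /=; rewrite fineK.
  rewrite -nuE (Radon_Nikodym_integral numu)//.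
  rewrite /mu /distribution (integral_pushforward mid mf)//.
  by apply: integrableS fPi => //; exact: Gm.
Qed.

Lemma cond_expP G X : sigma_algebra setT G -> G `<=` measurable ->
  P.-integrable [set: T] (EFin \o X) -> is_cond_exp G X (cond_exp G X).
Proof. by move=> sG Gm iX; apply: xgetPex; exact: cond_exp_exists. Qed.

Lemma cond_exp_unique G X Y Y' : sigma_algebra setT G -> G `<=` measurable ->
  is_cond_exp G X Y -> is_cond_exp G X Y' -> {ae P, forall w, Y w = Y' w}.
Proof.
move=> sG Gm [mY iY YX] [mY' iY' Y'X]; pose T' := g_sigma_algebraType G.
have GE : (@measurable _ T') = G := sigma_algebra_id sG.
have mid : measurable_fun [set: T] (id : T -> T').
  by move=> _ B mB; rewrite setTI; apply: Gm; rewrite -GE.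
pose idm : {mfun T >-> T'} := mfun_Sub (mem_set mid).
pose mu : probability T' R := distribution P idm.
have eY : measurable_fun [set: T'] (EFin \o Y) by exact/measurable_EFinP.
have eY' : measurable_fun [set: T'] (EFin \o Y') by exact/measurable_EFinP.
have : ae_eq mu [set: T'] (EFin \o Y) (EFin \o Y').
  apply: integral_ae_eq => //.
    exact: (integrable_pushforward mid eY).
  move=> A _ mA; have GA : G A by rewrite -GE.
  rewrite /mu /distribution (integral_pushforward mid eY)//; last first.
    by apply: integrableS iY => //; exact: Gm.
  rewrite (integral_pushforward mid eY')//; last first.
    by apply: integrableS iY' => //; exact: Gm.
  exact: etrans (YX _ GA) (esym (Y'X _ GA)).
case=> N [mN N0 sN]; exists N; split => //.
  by apply: Gm; rewrite -GE.
by move=> w /= YY'; apply: sN => /= H; apply: YY'; have [] := H I.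
Qed.

End conditional_expectation.

Definition filtration d (T : measurableType d) (F : nat -> set (set T)) : Prop :=
  [/\ forall n, sigma_algebra [set: T] (F n),
      forall n, F n `<=` measurable &
      forall m n, (m <= n)%N -> F m `<=` F n].

Section supermartingale.
Context d (T : measurableType d) (R : realType) (P : probability T R).
Variables (F : nat -> set (set T)) (M : nat -> T -> R).

Record nonneg_supermartingale : Prop := {
  supermartingale_adapted : forall n, measurable_wrt (F n) (M n) ;
  supermartingale_ge0 : forall n, {ae P, forall w, 0 <= M n w} ;
  supermartingale_lty : forall n, ('E_P[M n] < +oo)%E ;
  supermartingale_le : forall n, (1 <= n)%N ->
    {ae P, forall w, cond_exp P (F n.-1) (M n) w <= M n.-1 w} }.

Definition decrement (n : nat) (w : T) : R :=
  M n.-1 w - cond_exp P (F n.-1) (M n) w.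

Variable b : R.

Definition hitting_time (w : T) : \bar R :=
  ereal_inf [set n%:R%:E | n in [set n : nat | (1 <= n)%N /\ b <= M n w]].

Definition hit : set T := [set w | (hitting_time w < +oo)%E].

(* M_{T_b}; the value M 0 w taken where T_b = +oo is irrelevant, as this is only
   used on the event [hit]. *)
Definition stopped_value (w : T) : R :=
  M (Num.truncn (fine (hitting_time w))) w.

Definition supermartingale_loss : \bar R :=
  (\sum_(1 <= i <oo)
     'E_P[(decrement i \* \1_[set w | (i%:R%:E <= hitting_time w)%E])%R])%E.

Definition expected_overshoot : \bar R :=
  (if P hit == 0 then 0
   else 'E_P[((fun w => stopped_value w - b) \* \1_hit)%R] / P hit)%E.

Definition survival_mass (n : nat) : \bar R :=
  'E_P[(M n \* \1_[set w | (n%:R%:E < hitting_time w)%E])%R]%E.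

End supermartingale.

(* Main.v *)
Require Import Defs.
From HB Require Import structures.
From mathcomp Require Import all_boot all_order all_algebra.
From mathcomp Require Import all_classical all_reals all_analysis.
From mathcomp Require Import measurable_realfun.
From mathcomp Require Import ring lra.

Set Implicit Arguments.
Unset Strict Implicit.

Import Order.TTheory GRing.Theory Num.Theory.
Import numFieldNormedType.Exports.

Local Open Scope classical_set_scope.
Local Open Scope ring_scope.

(** The proof is a mass balance. Write A_n for the event that M_1, ..., M_n all
    stay below b; it is the event {T_b > n} = {T_b >= n + 1}, and it belongs to
    F_n. The mass E[M_n 1(A_n)] still running at time n is split in three by the
    next step: E[delta_(n+1) 1(A_n)] is lost, by the definition of the
    conditional expectation and since A_n is in F_n; the remaining
    E[M_(n+1) 1(A_n)] is absorbed on A_n \ A_(n+1) = {T_b = n + 1}, or is still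
    running on A_(n+1) ([supermartingale_step]).

    All three terms are nonnegative and the initial mass is 1. Hence the running
    mass is nonincreasing, so that its limit R_b exists, and the accumulated loss
    and absorbed mass stay at most 1, so that both series converge, with sum
    1 - R_b ([mass_balance]). The sum of the losses is D_b by definition. The sum
    of the absorbed masses is E[M_(T_b) 1(T_b < oo)] by countable additivity of
    the integral over the disjoint events {T_b = n + 1}, the integrand being at
    least b > 0 there ([integral_stopped_value]).

    The formula for the probability comes from
    E[M_(T_b) 1(T_b < oo)] = (b + O_b) P(T_b < oo), which only restates the
    definition of O_b ([prob_hit_overshoot]). *)

(** * Hitting times of integer-indexed paths *)

Section hitting_time.
Context d (T : measurableType d) (R : realType).
Variables (M : nat -> T -> R) (b : R).

(** Times are shifted by one, as the path is watched from time 1 on: [below n] is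
    the event T_b > n and [first_hit n] the event T_b = n + 1. *)
Definition below (n : nat) : set T :=
  [set w | forall k, (k < n)%N -> M k.+1 w < b].

Definition first_hit (n : nat) : set T := below n `\` below n.+1.

Lemma below_anti m n : (m <= n)%N -> below n `<=` below m.
Proof. by move=> mn w H k km; apply: H; exact: leq_trans mn. Qed.

Lemma belowS n : below n.+1 = below n `&` [set w | M n.+1 w < b].
Proof.
apply/seteqP; split=> w.
- by move=> H; split; [exact: below_anti H|exact: H].
- move=> [H Hn] k; rewrite ltnS leq_eqVlt => /predU1P[->//|]; exact: H.
Qed.

Lemma first_hitE n : first_hit n = below n `&` [set w | b <= M n.+1 w].
Proof.
apply/seteqP; split=> w; rewrite /first_hit belowS.
- by move=> [H nH]; split => //=; rewrite leNgt; apply/negP => ?; apply: nH.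
- by move=> [H /= bM]; split => //= -[_]; rewrite ltNge bM.
Qed.

Lemma below_split n : below n = below n.+1 `|` first_hit n.
Proof. by rewrite /first_hit setDUK//; exact: below_anti. Qed.

Lemma trivIset_first_hit : trivIset setT first_hit.
Proof.
have key i j w : (i < j)%N -> first_hit i w -> first_hit j w -> False.
  by move=> ij [_ nS] [Hj _]; apply: nS; exact: below_anti Hj.
apply/trivIsetP => i j _ _; rewrite neq_lt => /orP[] ij;
  apply/seteqP; split=> // w [] Hi Hj.
- exact: key ij Hi Hj.
- exact: key ij Hj Hi.
Qed.

(** A nonempty set of integers attains its infimum. Together with the two lemmas
    that follow, this replaces the extended-real infimum by a case distinction on
    integer times. *)
Lemma hitting_time_first_hit n w :
  first_hit n w -> hitting_time M b w = n.+1%:R%:E.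
Proof.
rewrite first_hitE => -[nb bM]; apply/eqP; rewrite eq_le; apply/andP; split.
  by apply: ereal_inf_lbound; exists n.+1.
apply/ereal_infP => _ [[|k] [k1 bMk] <-] //; rewrite lee_fin ler_nat leqNgt.
by apply/negP => kn; have := nb k kn; rewrite ltNge bMk.
Qed.

Lemma hitting_time_below w : (forall n, below n w) -> hitting_time M b w = +oo%E.
Proof.
move=> H; apply/eqP; rewrite -leye_eq.
apply/ereal_infP => _ [[|k] [k1 bMk] <-] //.
by have := H k.+1 k (ltnSn k); rewrite ltNge bMk.
Qed.

Lemma first_hit_or_below w : (exists n, first_hit n w) \/ forall n, below n w.
Proof.
have [|nE] := pselect (exists n, b <= M n.+1 w); last first.
  by right=> n k _; rewrite ltNge; apply/negP => bM; apply: nE; exists k.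
move=> E; left; case: (ex_minnP E) => n bM nmin; exists n; rewrite first_hitE.
split=> //= k kn; rewrite ltNge; apply/negP => /nmin.
by rewrite leqNgt kn.
Qed.

(** Because T_b takes integer values, T_b > n and T_b >= n + 1 are the same event:
    one family of events serves both the surviving mass and the loss. *)
Lemma lt_hitting_time n :
  [set w | (n%:R%:E < hitting_time M b w)%E] = below n.
Proof.
apply/seteqP; split=> w /=; have [[m Hm]|H] := first_hit_or_below w => //.
- rewrite (hitting_time_first_hit Hm)// lte_fin ltr_nat ltnS => nm.
  by case: Hm => Hm _; exact: below_anti Hm.
- rewrite (hitting_time_first_hit Hm)// lte_fin ltr_nat ltnS leqNgt => Hn.
  by apply/negP => mn; case: Hm => _; apply; exact: below_anti Hn.
- by rewrite hitting_time_below// ltry.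
Qed.

Lemma le_hitting_time n :
  [set w | (n.+1%:R%:E <= hitting_time M b w)%E] = below n.
Proof.
rewrite -lt_hitting_time; apply/seteqP; split=> w /=;
  have [[m Hm]|H] := first_hit_or_below w;
  by rewrite ?(hitting_time_first_hit Hm)// ?hitting_time_below// ?ltry ?leey//
     lee_fin lte_fin ler_nat ltr_nat.
Qed.

Lemma hit_bigcup : hit M b = \bigcup_n first_hit n.
Proof.
apply/seteqP; split=> w; rewrite /hit /=.
- have [[m Hm]|H] := first_hit_or_below w; first by exists m.
  by rewrite hitting_time_below// ltxx.
- by move=> [m _ Hm]; rewrite (hitting_time_first_hit Hm)// ltry.
Qed.

Lemma stopped_value_first_hit n w :
  first_hit n w -> stopped_value M b w = M n.+1 w.
Proof.
by move=> /hitting_time_first_hit tE; rewrite /stopped_value tE/= natrK.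
Qed.

(** This bound holds at every point of the event, whereas M is nonnegative only
    almost surely; it is what allows countable additivity of the integral without
    discarding a null set. *)
Lemma stopped_value_ge w : hit M b w -> b <= stopped_value M b w.
Proof.
rewrite hit_bigcup => -[n _ Hn]; rewrite (stopped_value_first_hit Hn)//.
by move: Hn; rewrite first_hitE => -[].
Qed.

End hitting_time.

(** * A telescoping mass balance *)

(** If a nonnegative quantity [s] loses [l n] and [h n] at step [n], then after [n]
    steps it has lost s 0 - s n in total. The partial sums of both nonnegative series
    are thus bounded by [s 0], and [s] is nonincreasing. *)
Lemma mass_balance (R : realType) (s l h : R^nat) :
  (forall n, 0 <= s n) -> (forall n, 0 <= l n) -> (forall n, 0 <= h n) ->
  (forall n, s n = l n + h n + s n.+1) ->
  exists r H : R, [/\ 0 <= r, s @ \oo --> r, series h @ \oo --> H &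
    series l @ \oo --> s 0%N - H - r].
Proof.
move=> s0 l0 h0 sE.
have sumE n : series l n = s 0%N - series h n - s n.
  elim: n => [|n IH]; first by rewrite /series/= !big_geq// subr0 subrr.
  by rewrite !seriesSr IH (sE n); ring.
have cs : cvgn s.
  apply: nonincreasing_is_cvgn.
    apply/nonincreasing_seqP => n; rewrite [leRHS]sE lerDr addr_ge0//.
  by exists 0 => _ [n _ <-].
have ch : cvgn (series h).
  apply: nondecreasing_is_cvgn.
    by apply/nondecreasing_seqP => n; rewrite seriesSr lerDl.
  exists (s 0%N) => _ [n _ <-].
  have : 0 <= series l n by rewrite /series/= sumr_ge0.
  by rewrite sumE; have := s0 n; lra.
exists (limn s), (limn (series h)); split => //.
  by apply: limr_ge => //; apply: nearW.
rewrite (_ : series l = fun n => s 0%N - series h n - s n); last exact/funext.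
by apply: cvgB => //; apply: cvgB => //; exact: cvg_cst.
Qed.

(** * Integrals over events *)

Section integrals.
Context d (T : measurableType d) (R : realType) (P : probability T R).

Lemma expectation_setI (X : T -> R) (A : set T) :
  ('E_P[(X \* \1_A)%R] = \int[P]_(w in A) (X w)%:E)%E.
Proof.
rewrite unlock [RHS]integral_mkcond epatch_indic.
by apply: eq_integral => w _ /=; rewrite EFinM.
Qed.

(** The integral of nonnegative functions asks for pointwise nonnegativity; passing
    to the absolute value reduces the almost sure case to it. *)
Lemma ae_ge0_integral_abs (X : T -> R) (A : set T) :
  measurable A -> measurable_fun setT X -> {ae P, forall w, 0 <= X w} ->
  (\int[P]_(w in A) (X w)%:E = \int[P]_(w in A) `|(X w)%:E|)%E.
Proof.
move=> mA mX X0; have mXA : measurable_fun A (EFin \o X).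
  by apply/measurable_EFinP; exact: measurable_funTS.
apply: ae_eq_integral => //; first exact: measurableT_comp.
by apply: filterS X0 => w /= X0 _; rewrite ger0_norm.
Qed.

Lemma ae_integral_ge0 (X : T -> R) (A : set T) :
  measurable A -> measurable_fun setT X -> {ae P, forall w, 0 <= X w} ->
  (0 <= \int[P]_(w in A) (X w)%:E)%E.
Proof.
by move=> mA mX X0; rewrite ae_ge0_integral_abs//; exact: integral_ge0.
Qed.

Lemma measurable_wrt_measurable (G : set (set T)) (X : T -> R) :
  sigma_algebra setT G -> G `<=` measurable ->
  measurable_wrt G X -> measurable_fun setT X.
Proof.
move=> sG Gm mX _ B mB; apply: Gm; rewrite -(sigma_algebra_id sG).
exact: mX.
Qed.

End integrals.

(** * The stopped supermartingale *)

Section stopped_supermartingale.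
Context d (T : measurableType d) (R : realType) (P : probability T R).
Variables (F : nat -> set (set T)) (M : nat -> T -> R) (b : R).
Hypotheses (filF : filtration F) (supM : nonneg_supermartingale P F M).

Lemma supermartingale_measurable n : measurable_fun setT (M n).
Proof.
case: filF => sF Fm _; apply: measurable_wrt_measurable (sF n) (Fm n) _.
exact: supermartingale_adapted supM n.
Qed.

Lemma supermartingale_integrable n : P.-integrable setT (EFin \o M n).
Proof.
apply/integrableP; split.
  by apply/measurable_EFinP; exact: supermartingale_measurable.
rewrite /= -ae_ge0_integral_abs//; last 2 first.
- exact: supermartingale_measurable.
- exact: supermartingale_ge0 supM n.
by have := supermartingale_lty supM n; rewrite unlock.
Qed.

Lemma supermartingale_cond_exp n :
  is_cond_exp P (F n) (M n.+1) (cond_exp P (F n) (M n.+1)).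
Proof.
by case: filF => sF Fm _; apply: cond_expP => //; exact: supermartingale_integrable.
Qed.

(** T_b is a stopping time; this is what gives access to the defining property of
    the conditional expectation on [below M b n]. *)
Lemma below_adapted n : F n (below M b n).
Proof.
case: filF => sF _ Fmono; elim: n => [|n IH].
  have -> : below M b 0 = setT by apply/seteqP; split.
  rewrite -(sigma_algebra_id (sF 0%N)).
  exact: (@measurableT _ (g_sigma_algebraType (F 0%N))).
rewrite belowS -(sigma_algebra_id (sF n.+1)).
apply: (@measurableI _ (g_sigma_algebraType (F n.+1))).
  by rewrite /measurable/= (sigma_algebra_id (sF n.+1)); exact: Fmono IH.
have := supermartingale_adapted supM (n := n.+1) measurableT (measurable_itv `]-oo, b[).
by rewrite setTI.
Qed.

Lemma below_measurable n : measurable (below M b n).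
Proof. by case: filF => _ Fm _; apply: Fm; exact: below_adapted. Qed.

Lemma first_hit_measurable n : measurable (first_hit M b n).
Proof. by apply: measurableD; exact: below_measurable. Qed.

Lemma hit_measurable : measurable (hit M b).
Proof.
by rewrite hit_bigcup; apply: bigcupT_measurable => n; exact: first_hit_measurable.
Qed.

Lemma stopped_value_measurable : measurable_fun (hit M b) (stopped_value M b).
Proof.
rewrite hit_bigcup; apply/measurable_fun_bigcup => n.
  exact: first_hit_measurable.
apply: (eq_measurable_fun (M n.+1)) => [w|].
  by rewrite inE => /stopped_value_first_hit ->.
by apply: measurable_funTS; exact: supermartingale_measurable.
Qed.

Lemma decrement_integrable n : P.-integrable setT (EFin \o decrement P F M n.+1).
Proof.
have [_ iC _] := supermartingale_cond_exp n.
exact: integrableB (supermartingale_integrable n) iC.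
Qed.

Lemma decrement_ge0 n : {ae P, forall w, 0 <= decrement P F M n.+1 w}.
Proof.
have := supermartingale_le supM (ltn0Sn n).
by apply: filterS => w; rewrite /decrement subr_ge0.
Qed.

(** One step of the balance: the conditional expectation given F_n integrates over
    the F_n-event [below M b n] as M_(n+1) does, and this event splits according to
    whether b is reached at time n + 1. *)
Lemma supermartingale_step n :
  \int[P]_(w in below M b n) M n w =
    \int[P]_(w in below M b n) decrement P F M n.+1 w
    + \int[P]_(w in first_hit M b n) M n.+1 w
    + \int[P]_(w in below M b n.+1) M n.+1 w.
Proof.
have mA := below_measurable.
have iM k A : measurable A -> P.-integrable A (EFin \o M k).
  by move=> ?; apply: integrableS (supermartingale_integrable k).
have [_ iC CE] := supermartingale_cond_exp n.
rewrite /decrement RintegralB//; last 2 first.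
- exact: iM.
- exact: integrableS iC.
rewrite [X in _ - X](_ : _ = \int[P]_(w in below M b n) M n.+1 w); last first.
  by rewrite /Rintegral CE//; exact: below_adapted.
(* What is left is the integral of M_(n+1) over [below M b n]; it is cut at time
   n + 1. *)
rewrite [X in _ - X](_ : _ = \int[P]_(w in first_hit M b n) M n.+1 w +
    \int[P]_(w in below M b n.+1) M n.+1 w); first by ring.
rewrite addrC {1}below_split Rintegral_setU//.
- exact: first_hit_measurable.
- by rewrite -below_split; exact: iM.
- by apply/disj_setPS => w [Hn [_]].
Qed.

Lemma integral_stopped_value : 0 <= b ->
  (\int[P]_(w in hit M b) (stopped_value M b w)%:E =
   \sum_(0 <= n <oo) \int[P]_(w in first_hit M b n) (M n.+1 w)%:E)%E.
Proof.
move=> b0; have := stopped_value_measurable; have := @stopped_value_ge _ _ _ M b.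
rewrite hit_bigcup => Sb mS; rewrite ge0_integral_bigcup//.
- apply: eq_eseriesr => n _; apply: eq_integral => w; rewrite inE.
  by move=> /stopped_value_first_hit ->.
- exact: first_hit_measurable.
- exact/measurable_EFinP.
- by move=> w /Sb; rewrite lee_fin; exact: le_trans.
- exact: trivIset_first_hit.
Qed.

(** The balance in its infinite form. The three quantities are given as real
    numbers, so that the subtractions in the theorem cannot meet infinities. *)
Lemma stopped_mass_balance : {ae P, forall w, M 0%N w = 1} -> 0 <= b ->
  exists r H : R, [/\ 0 <= r, survival_mass P M b @ \oo --> r%:E,
    ('E_P[(stopped_value M b \* \1_(hit M b))%R] = H%:E)%E &
    supermartingale_loss P F M b = (1 - H - r)%:E].
Proof.
move=> M01 b0.
have mA := below_measurable; have mB := first_hit_measurable.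
have fin X A : measurable A -> P.-integrable setT (EFin \o X) ->
    (\int[P]_(w in A) (X w)%:E = (\int[P]_(w in A) X w)%:E)%E.
  move=> mX iX; rewrite fineK//; apply: integrable_fin_num => //.
  exact: integrableS iX.
have pos X A : measurable A -> P.-integrable setT (EFin \o X) ->
    {ae P, forall w, 0 <= X w} -> 0 <= \int[P]_(w in A) X w.
  move=> mX iX X0; apply: fine_ge0; apply: ae_integral_ge0 => //.
  by apply/measurable_EFinP; exact: measurable_int iX.
have iM := supermartingale_integrable; have iD := decrement_integrable.
have M0 n := supermartingale_ge0 supM n.
have [||||r [H [r0 cs ch cl]]] := @mass_balance R
  (fun n => \int[P]_(w in below M b n) M n w)
  (fun n => \int[P]_(w in below M b n) decrement P F M n.+1 w)
  (fun n => \int[P]_(w in first_hit M b n) M n.+1 w).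
- by move=> n; apply: pos.
- by move=> n; apply: pos => //; exact: decrement_ge0.
- by move=> n; apply: pos.
- exact: supermartingale_step.
have s0E : \int[P]_(w in below M b 0%N) M 0%N w = 1.
  have -> : below M b 0 = setT by apply/seteqP; split.
  rewrite /Rintegral (ae_eq_integral (cst 1%E))//.
  - by rewrite integral_cst// mul1e [X in fine X]probability_setT.
  - exact: measurable_int (iM 0%N).
  - by apply: filterS M01 => w /= -> _.
exists r, H; split=> //.
- rewrite (_ : survival_mass P M b =
    EFin \o (fun n => \int[P]_(w in below M b n) M n w)).
    by apply: cvg_EFin; [exact: nearW|exact: cs].
  by apply/funext => n; rewrite /survival_mass lt_hitting_time expectation_setI fin.
- rewrite expectation_setI integral_stopped_value//.
  apply/cvg_lim => //.
  rewrite [X in X @ _](_ : _ = EFin \o series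
    (fun n => \int[P]_(w in first_hit M b n) M n.+1 w)).
    by apply: cvg_EFin; [exact: nearW|exact: ch].
  by apply/funext => n; rewrite /= -sumEFin; apply: eq_bigr => i _; rewrite fin.
(* The loss is summed from index 1, hence the shift by one of its partial sums. *)
- apply/cvg_lim => //; rewrite -[X in X - H]s0E -cvg_shiftS.
  rewrite [X in X @ _](_ : _ = EFin \o series
    (fun n => \int[P]_(w in below M b n) decrement P F M n.+1 w)).
    by apply: cvg_EFin; [exact: nearW|exact: cl].
  apply/funext => n; rewrite /= -sumEFin big_add1/=; apply: eq_bigr => i _.
  by rewrite le_hitting_time expectation_setI fin.
Qed.

(** By linearity over the event [hit], O_b = H / p - b where p is its probability,
    so that b + O_b = H / p. Dividing by H / p is legitimate for p > 0, because
    H >= b p > 0; for p = 0 the convention O_b = 0 turns the claim into 0 = 0 / b. *)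
Lemma prob_hit_overshoot H : 0 < b ->
  ('E_P[(stopped_value M b \* \1_(hit M b))%R] = H%:E)%E ->
  (P (hit M b) = H%:E / (b%:E + expected_overshoot P M b))%E.
Proof.
move=> b0; rewrite expectation_setI => HE.
have mh := hit_measurable; set p := P (hit M b).
have iS : P.-integrable (hit M b) (EFin \o stopped_value M b).
  apply/integrableP; split.
    by apply/measurable_EFinP; exact: stopped_value_measurable.
  rewrite (eq_integral (EFin \o stopped_value M b)); last first.
    move=> w; rewrite inE => /stopped_value_ge bS /=.
    by rewrite ger0_norm// (le_trans _ bS)// ltW.
  by rewrite HE ltry.
have pfin : p \is a fin_num by exact: fin_num_measure.
have pE : p = (fine p)%:E by rewrite fineK.
have ib : P.-integrable (hit M b) (EFin \o cst b).
  exact: finite_measure_integrable_cst.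
have ibE : (\int[P]_(w in hit M b) (cst b w)%:E = (b * fine p)%:E)%E.
  by rewrite EFinM -pE; exact: (integral_cst P mh b%:E).
rewrite /expected_overshoot -/p; have [p0|p0] := eqVneq p 0%E.
  suff -> : H%:E = 0%E by rewrite mul0e.
  by rewrite -HE null_set_integral//; exact: measurable_int iS.
have q0 : 0 < fine p.
  by rewrite fine_gt0// lt_neqAle eq_sym p0 measure_ge0 ltey_eq pfin.
have H0 : 0 < H.
  apply: (@lt_le_trans _ _ (b * fine p)); first exact: mulr_gt0.
  rewrite -lee_fin -HE -ibE; apply: le_integral => // w; rewrite inE.
  by move=> /stopped_value_ge.
rewrite expectation_setI (_ : (\int[P]_(w in _) _)%E = (H - b * fine p)%:E).
  rewrite pE inver gt_eqF// -EFinM -EFinD inver.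
  rewrite (_ : b + _ = H / fine p); last by field; rewrite gt_eqF.
  by rewrite gt_eqF ?divr_gt0// -EFinM; congr EFin; field; rewrite !gt_eqF.
by rewrite EFinB -HE -ibE -integralB.
Qed.

End stopped_supermartingale.

Unset Implicit Arguments.

Theorem theorem5p2 (d : measure_display) (T : measurableType d) (R : realType)
    (P : probability T R) (F : nat -> set (set T)) (M : nat -> T -> R) (b : R) :
  filtration F ->
  nonneg_supermartingale P F M ->
  {ae P, forall w, M 0%N w = 1} ->
  1 < b ->
  ('E_P[(stopped_value M b \* \1_(hit M b))%R] < +oo)%E ->
  let D_b := supermartingale_loss P F M b in
  let O_b := expected_overshoot P M b in
  let R_b := limn (survival_mass P M b) in
  [/\ cvgn (survival_mass P M b),
      (0 <= R_b < +oo)%E,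
      ('E_P[(stopped_value M b \* \1_(hit M b))%R] = 1 - D_b - R_b)%E &
      (P (hit M b) = (1 - D_b - R_b) / (b%:E + O_b))%E].
Proof.
move=> filF supM M01 b1 _ D_b O_b R_b.
have b0 : 0 < b by exact: lt_trans b1.
have [r [H [r0 cs HE DE]]] := stopped_mass_balance filF supM M01 (ltW b0).
have RE : R_b = r%:E by exact/cvg_lim.
have balance : (1 - D_b - R_b)%E = H%:E.
  by rewrite RE /D_b DE -!EFinB; congr EFin; ring.
split; first by apply/cvg_ex; exists r%:E.
- by rewrite RE lee_fin r0 ltry.
- by rewrite balance.
- by rewrite balance; exact: (prob_hit_overshoot filF supM b0 HE).
Qed.
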